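(* Let $(X,\mathbb{X},\mu)$ be a measure space and let $p\in[1,\infty)$. If $(f_n)$ is an $\alpha_p$-Cauchy sequence of measurable functions on $X$, then there exists a measurable function $f$ on $X$ such that $(f_n)$ $\alpha_p$-converges to $f$.
   Context: Measurable functions are $\mathbb{X}$-measurable real-valued functions on $X$; $(X,\mathbb{X},\mu)$ is an arbitrary measure space. For $B\in\mathbb{X}$, $B^c$ denotes the complement of $B$ in $X$. A sequence $(f_n)$ of measurable functions is said to be $\alpha_p$-Cauchy if there exists a sequence of measurable sets $(B_n)$ with $\mu(B_n^c)\to 0$ as $n\to\infty$ such that $\int_{B_n\cap B_m}|f_n-f_m|^p\,d\mu\to 0$ as $n,m\to\infty$. A sequence $(f_n)$ of measurable functions is said to $\alpha_p$-converge to a measurable function $f$ if there exists a sequence of measurable sets $(B_n)$ with $\mu(B_n^c)\to 0$ as $n\to\infty$ such that $\int_{B_n}|f_n-f|^p\,d\mu\to 0$ as $n\to\infty$. *)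

(* Defs.v *)
From mathcomp Require Import all_boot all_order all_algebra.
From mathcomp Require Import all_classical all_reals all_analysis.

Set Implicit Arguments.
Unset Strict Implicit.
Unset Printing Implicit Defensive.

Import Order.TTheory GRing.Theory Num.Theory.
Import numFieldNormedType.Exports.

Local Open Scope classical_set_scope.
Local Open Scope ring_scope.

(* The functions are meant to be measurable; users state that separately.
   Integrals and measures take values in [\bar R], so the limits below are
   limits of extended reals: finitely many terms may equal [+oo]. *)

(* The double limit is along the product filter: both indices tend to
   infinity independently. *)
Definition alpha_cauchy (d : measure_display) (X : measurableType d)
    (R : realType) (mu : {measure set X -> \bar R}) (p : R)
    (f : nat -> X -> R) : Prop :=
  exists B : nat -> set X,
    [/\ forall n, measurable (B n),
        mu (~` B n) @[n --> \oo] --> 0%E &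
        (\int[mu]_(x in B nm.1 `&` B nm.2)
           ((`|f nm.1 x - f nm.2 x| `^ p)%:E))%E @[nm --> (\oo, \oo)] --> 0%E].

Definition alpha_converges (d : measure_display) (X : measurableType d)
    (R : realType) (mu : {measure set X -> \bar R}) (p : R)
    (f : nat -> X -> R) (g : X -> R) : Prop :=
  exists B : nat -> set X,
    [/\ forall n, measurable (B n),
        mu (~` B n) @[n --> \oo] --> 0%E &
        (\int[mu]_(x in B n) ((`|f n x - g x| `^ p)%:E))%E @[n --> \oo]
          --> 0%E].

(* Main.v *)
Require Import Defs.
From mathcomp Require Import all_boot all_order all_algebra.
From mathcomp Require Import all_classical all_reals all_analysis.
From mathcomp Require Import measurable_realfun.

(** The proof is the Riesz-Fischer argument, run outside exceptional sets that
    are small in measure.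

    Because the double limit controls all pairs of large indices at once, one
    can pick indices [phi k] so large that there are sets [E k] of measure at
    most [2 / 2^(k+1)] with the following property: points outside [E k] lie in
    [B (phi k)], and at points outside both [E k] and [E k.+1] the consecutive
    terms [f (phi k)] and [f (phi k.+1)] differ by at most [2^-k].  The second
    part comes from Markov's inequality applied to the [p]-th power of
    the difference ([alpha_cauchy_subsequence]).  The tails
    [T n = \bigcup_(k >= n) E k] have measure tending to [0]
    ([measure_bigcup_tail_cvg0]), and off each [T n] the subsequence converges
    pointwise, its steps being dominated by a geometric series
    ([cvgn_geometric_steps]).  Let [g] be the limit.

    The sets witnessing convergence are [C n = B n `\` T n].  Their complements
    have measure at most [mu (~` B n) + mu (T n)], which tends to [0].  For
    [k >= n] the set [C n] is contained in [B n `&` B (phi k)], so the integral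
    over [C n] of [|f n - f (phi k)|^p] is at most [e] as soon as [n] and
    [phi k] are large; Fatou's lemma in [k] ([fatou_powR]) transfers this bound
    to [|f n - g|^p]. *)

Set Implicit Arguments.
Unset Strict Implicit.
Unset Printing Implicit Defensive.

Import Order.TTheory GRing.Theory Num.Theory.
Import numFieldNormedType.Exports.

Local Open Scope classical_set_scope.
Local Open Scope ring_scope.

(** * Limits of sequences *)

(** The [e]-bounds are non-strict and of finite value, so they also give the
    finiteness of the terms that convergence in [\bar R] to a real number
    requires. *)
Lemma ge0_cvge0P (R : realType) (I : Type) (F : set_system I) (FF : Filter F)
    (u : I -> \bar R) (u_ge0 : forall i, (0 <= u i)%E) :
  u i @[i --> F] --> 0%E <->
  forall e, 0 < e -> \forall i \near F, (u i <= e%:E)%E.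
Proof.
split=> [u0 e e_gt0|small].
  have e_nbhs : ereal_nbhs (0 : \bar R)%E (fun y => (y < e%:E)%E).
    by apply: open_ereal_lt'; rewrite lte_fin.
  have uF : \forall i \near F, (u i < e%:E)%E := u0 _ e_nbhs.
  by apply: filterS uF => i /ltW.
apply/fine_cvgP; split.
  apply: filterS (small 1 ltr01) => i ui.
  by rewrite ge0_fin_numE// (le_lt_trans ui)// ltry.
apply/cvgr0Pnorm_le => e e_gt0; apply: filterS (small e e_gt0) => i ui /=.
rewrite ger0_norm ?fine_ge0//.
by rewrite -lee_fin fineK// ge0_fin_numE// (le_lt_trans ui)// ltry.
Qed.

(** On positive reals the power function is differentiable.  At [0] it has a
    jump, since [powR] is [1] on negative reals; the nonnegative values
    [|u n|] avoid it, and [|u n| < e^(1/p)] gives [|u n|^p < e]. *)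
Lemma cvg_powR_norm (R : realType) (p : R) (p_gt0 : 0 < p)
    (u : nat -> R) (l : R) :
  u n @[n --> \oo] --> l -> `|u n| `^ p @[n --> \oo] --> `|l| `^ p.
Proof.
move=> /cvg_norm ul; have [l0|l0] := eqVneq l 0.
  rewrite l0 normr0 powR0 ?gt_eqF//.
  apply/cvgr0Pnorm_lt => e e_gt0.
  have e'_gt0 : 0 < e `^ p^-1 by exact: powR_gt0.
  move: ul; rewrite l0 normr0 => /cvgr0Pnorm_lt/(_ _ e'_gt0).
  apply: filterS => n un; rewrite ger0_norm ?powR_ge0//.
  have -> : e = (e `^ p^-1) `^ p.
    by rewrite -powRrM mulVf ?gt_eqF// powRr1// ltW.
  rewrite normr_id in un.
  by apply: gt0_ltr_powR => //; rewrite nnegrE ?powR_ge0.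
apply: (@continuous_cvg _ _ _ _ _ _ (@powR R ^~ p)) ul.
apply: differentiable_continuous; apply/derivable1_diffP.
by apply: derivable_powR; rewrite in_itv/= andbT normr_gt0.
Qed.

(** The tail of the sequence is a telescoping series dominated by a geometric
    one.  The bound may fail for finitely many [k], as happens at a point that
    lies in finitely many exceptional sets. *)
Lemma cvgn_geometric_steps (R : realType) (u : nat -> R) (N : nat) :
  (forall k, (N <= k)%N -> `|u k.+1 - u k| <= 2^-1 ^+ k) -> cvgn u.
Proof.
move=> step; suff /cvg_ex[l vl] : cvgn (fun k => u (k + N)%N).
  by apply/cvg_ex; exists l; rewrite -(cvg_shiftn N).
pose v k := u (k + N)%N.
have -> : (fun k => u (k + N)%N) = (fun n => v 0%N + series (telescope v) n).
  by apply/funext => n; rewrite -(eq_sum_telescope v).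
apply: is_cvgD; first exact: is_cvg_cst.
apply: normed_cvg; apply: (@series_le_cvg _ _ (geometric 1 2^-1)) => [k|k|k|].
- exact: normr_ge0.
- by rewrite /geometric /= mul1r exprn_ge0.
- rewrite /geometric /= mul1r.
  rewrite (le_trans (step _ (leq_addl _ _)))//.
  by rewrite ler_wiXn2l ?leq_addr ?invr_ge0// invf_le1// ler1n.
- by apply: is_cvg_geometric_series; rewrite ger0_norm// invf_lt1// ltr1n.
Qed.

(** * Integrals of powers *)

Lemma measurable_powR_norm (d : measure_display) (X : measurableType d)
    (R : realType) (p : R) (D : set X) (h : X -> R) :
  measurable_fun D h -> measurable_fun D (fun x => `|h x| `^ p).
Proof.
move=> mh; apply: (measurableT_comp (measurable_powR p)).
exact: measurableT_comp.
Qed.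

(** This is Markov's inequality for the function [|h|^p], the threshold being
    put on the power rather than on [|h|]. *)
Lemma markov_powR (d : measure_display) (X : measurableType d) (R : realType)
    (mu : {measure set X -> \bar R}) (p : R) (D : set X) (mD : measurable D)
    (h : X -> R) (mh : measurable_fun D h) (c : R) (c_gt0 : 0 < c) :
  (c%:E * mu (D `&` [set x | (c <= `|h x| `^ p)%R])
   <= \int[mu]_(x in D) (`|h x| `^ p)%:E)%E.
Proof.
have mhp : measurable_fun D (EFin \o (fun x => `|h x| `^ p)).
  by apply/measurable_EFinP; exact: measurable_powR_norm.
have := le_integral_comp_abse mu mD (@measurable_id _ (\bar R) setT)
  (fun r => id) (fun x y _ _ => id) mhp c_gt0.
under eq_integral do rewrite /= ger0_norm ?powR_ge0//.

rewrite (_ : [set x | _] = [set x | (c <= `|h x| `^ p)%R])//.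
by apply/funext => x; rewrite /= lee_fin ger0_norm ?powR_ge0.
Qed.

(** A bound on the distance from [h] to a sequence in the [p]-th mean passes to
    the pointwise limit of the sequence, by Fatou's lemma.  A bound for large
    [k] is enough, because the lower limit ignores finitely many terms. *)
Lemma fatou_powR (d : measure_display) (X : measurableType d) (R : realType)
    (mu : {measure set X -> \bar R}) (p : R) (p_gt0 : 0 < p)
    (D : set X) (mD : measurable D) (h g : X -> R) (u : nat -> X -> R)
    (mh : measurable_fun D h) (mu_ : forall k, measurable_fun D (u k))
    (ug : forall x, D x -> u k x @[k --> \oo] --> g x) (e : \bar R) :
  (\forall k \near \oo, (\int[mu]_(x in D) (`|h x - u k x| `^ p)%:E <= e)%E) ->
  (\int[mu]_(x in D) (`|h x - g x| `^ p)%:E <= e)%E.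
Proof.
move=> int_le.
have -> : (\int[mu]_(x in D) (`|h x - g x| `^ p)%:E
    = \int[mu]_(x in D) limn_einf (fun k => (`|h x - u k x| `^ p)%:E))%E.
  apply: eq_integral => x; rewrite inE => Dx; apply/esym.
  apply: (cvg_limn_einf_sup _).1; apply: cvg_EFin; first exact: nearW.
  apply: cvg_powR_norm => //; apply: cvgB; first exact: cvg_cst.
  exact: ug.
apply: le_trans (fatou mu mD _ _) _ => [k|k x Dx|].
- apply/measurable_EFinP; apply: measurable_powR_norm.
  exact: measurable_funB.
- by rewrite lee_fin powR_ge0.
rewrite limn_einf_lim; apply: lime_le; first exact: is_cvg_einfs.
apply: filterS int_le => k; apply: le_trans.
by apply: ereal_inf_lbound; exists k => /=.
Qed.

(** * Extraction of the subsequence *)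

(** The quantitative half of the Borel-Cantelli lemma: the union of the [E k]
    with [k >= n] is bounded by the tail of a convergent series. *)
Lemma measure_bigcup_tail_cvg0 (d : measure_display) (X : measurableType d)
    (R : realType) (mu : {measure set X -> \bar R}) (E : nat -> set X) (c : R) :
  0 <= c -> (forall k, measurable (E k)) ->
  (forall k, (mu (E k) <= (c / (2 ^ k.+1)%:R)%:E)%E) ->
  mu (\bigcup_(k in ~` `I_n) E k) @[n --> \oo] --> 0%E.
Proof.
move=> c_ge0 mE muE.
apply: (@squeeze_cvge _ _ _ _ (cst 0%E) _
    (fun n => \sum_(n <= k <oo) mu (E k))%E); last 2 first.
- exact: cvg_cst.
- apply: nneseries_tail_cvg => //.
  rewrite (le_lt_trans _ (ltry c))//.
  apply: le_trans (epsilon_trick0 xpredT c_ge0).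
  exact: lee_nneseries.
apply: nearW => n; rewrite measure_ge0/=.
apply: measure_sigma_subadditive_tail => //.
exact: bigcup_measurable.
Qed.

(** [E k] gathers the points outside [B (phi k)] and those of
    [B (phi k) `&` B (phi k.+1)] where the two functions are at least [2^-k]
    apart.  The step bound needs [x] outside both [E k] and [E k.+1], since the
    integral of the difference is controlled on the intersection only.  Each of
    the two parts of [E k] has measure at most [1 / 2^(k+1)]. *)
Lemma alpha_cauchy_subsequence (d : measure_display) (X : measurableType d)
    (R : realType) (mu : {measure set X -> \bar R}) (p : R) (p_gt0 : 0 < p)
    (f : nat -> X -> R) (mf : forall n, measurable_fun [set: X] (f n))
    (B : nat -> set X) (mB : forall n, measurable (B n)) :
  mu (~` B n) @[n --> \oo] --> 0%E ->
  (\int[mu]_(x in B nm.1 `&` B nm.2)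
     ((`|f nm.1 x - f nm.2 x| `^ p)%:E))%E @[nm --> (\oo, \oo)] --> 0%E ->
  exists (phi : nat -> nat) (E : nat -> set X),
    [/\ forall k, (k <= phi k)%N,
        forall k, measurable (E k),
        forall k, (mu (E k) <= (2 / (2 ^ k.+1)%:R)%:E)%E,
        forall k, ~` E k `<=` B (phi k) &
        forall k x, ~ E k x -> ~ E k.+1 x ->
          `|f (phi k.+1) x - f (phi k) x| <= 2^-1 ^+ k].
Proof.
move=> Bc0 int0.
pose w k : R := 1 / (2 ^ k.+1)%:R.
have w_gt0 k : 0 < w k by rewrite divr_gt0// ltr0n expn_gt0.
(* The integral is required to be at most [c k * w k], so that Markov's
   inequality at level [c k] leaves a set of measure at most [w k]. *)
pose c k := (2^-1 ^+ k : R) `^ p.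
have c_gt0 k : 0 < c k by rewrite powR_gt0// exprn_gt0.
have /choice[N NP] : forall k, exists N, forall n m, (N <= n)%N -> (N <= m)%N ->
    (mu (~` B n) <= (w k)%:E)%E /\
    (\int[mu]_(x in B n `&` B m) (`|f n x - f m x| `^ p)%:E
     <= (c k * w k)%:E)%E.
  move=> k.
  move/ge0_cvge0P : Bc0 => /(_ (fun=> measure_ge0 _ _) _ (w_gt0 k))[N1 _ N1P].
  have cw_gt0 : 0 < c k * w k by rewrite mulr_gt0.
  move/ge0_cvge0P : int0 => /(_ _ _ cw_gt0)[].
    by move=> nm; apply: integral_ge0 => x _; rewrite lee_fin powR_ge0.
  move=> [P Q] [/= [N2 _ N2P] [N3 _ N3P]] PQ.
  exists (maxn N1 (maxn N2 N3)) => n m; rewrite !geq_max.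
  move=> /and3P[n1 n2 n3] /and3P[m1 m2 m3]; split; first exact: N1P.
  by apply: (PQ (n, m)); split; [exact: N2P|exact: N3P].
(* A sum of the thresholds makes [phi] monotone, so that both [phi k] and
   [phi k.+1] exceed [N k]; the summand [k] makes [phi] tend to infinity. *)
pose phi k := (k + \sum_(i < k.+1) N i)%N.
have N_phi k : (N k <= phi k)%N.
  by rewrite /phi big_ord_recr/= addnA leq_addl.
have N_phiS k : (N k <= phi k.+1)%N.
  apply: leq_trans (N_phi k) _.
  by rewrite /phi [in leqRHS]big_ord_recr/= leq_add// leq_addr.
pose J k := B (phi k.+1) `&` B (phi k) `&`
  [set x | c k <= `|f (phi k.+1) x - f (phi k) x| `^ p].
have mJ k : measurable (J k).
  have -> : J k = B (phi k.+1) `&` B (phi k) `&`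
      (fun x => `|f (phi k.+1) x - f (phi k) x| `^ p) @^-1` `[c k, +oo[.
    by rewrite /J; congr (_ `&` _); apply/seteqP; split => x /=;
      rewrite in_itv/= andbT.
  apply: measurable_powR_norm => //; last exact: measurableI.
  by apply: measurable_funB; exact: measurable_funTS.
exists phi, (fun k => ~` B (phi k) `|` J k); split.
- by move=> k; exact: leq_addr.
- by move=> k; apply: measurableU => //; exact: measurableC.
- move=> k; apply: le_trans (measureU2 _ _ _) _ => //; first exact: measurableC.
  rewrite (_ : 2 / _ = w k + w k) ?EFinD; last by rewrite -mulrDl.
  apply: leeD; first by have [] := NP k _ _ (N_phi k) (N_phi k).
  rewrite -(@lee_pmul2l _ (c k)%:E)// ?lte_fin// -EFinM.
  apply: le_trans (NP k _ _ (N_phiS k) (N_phi k)).2.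
  apply: markov_powR => //; first exact: measurableI.
  by apply: measurable_funB; exact: measurable_funTS.
- by move=> k x /not_orP[/contrapT].
- move=> k x /not_orP[/contrapT Bk nJ] /not_orP[/contrapT BSk _].
  rewrite leNgt; apply/negP => far; apply: nJ; split => //=.
  by apply: ge0_ler_powR; rewrite ?nnegrE ?exprn_ge0 ?invr_ge0//; exact: ltW.
Qed.

Theorem theorem3p3 (d : measure_display) (X : measurableType d) (R : realType)
    (mu : {measure set X -> \bar R}) (p : R) (hp : 1 <= p)
    (f : nat -> X -> R) (mf : forall n, measurable_fun [set: X] (f n))
    (hf : alpha_cauchy mu p f) :
  exists g : X -> R, measurable_fun [set: X] g /\ alpha_converges mu p f g.
Proof.
have p_gt0 : 0 < p by exact: lt_le_trans hp.
have [B [mB Bc0 int0]] := hf.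
have [phi [E [phi_ge mE muE EB Estep]]] :=
  alpha_cauchy_subsequence p_gt0 mf mB Bc0 int0.
pose T n := \bigcup_(k in ~` `I_n) E k.
have mT n : measurable (T n) by exact: bigcup_measurable.
have T0 : mu (T n) @[n --> \oo] --> 0%E.
  by apply: measure_bigcup_tail_cvg0 muE.
have notE n x : ~ T n x -> forall k, (n <= k)%N -> ~ E k x.
  by move=> nT k nk Ekx; apply: nT; exists k => //=; apply/negP; rewrite -leqNgt.
(* An upper limit is measurable on all of [X], including the points where the
   subsequence diverges. *)
pose g x := fine (limn_esup (fun k => (f (phi k) x)%:E)).
have mg : measurable_fun [set: X] g.
  apply: (measurableT_comp (fine_measurable measurableT)).
  apply: measurable_fun_limn_esup => k.
  by apply/measurable_EFinP; exact: mf.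
have fg n x : ~ T n x -> f (phi k) x @[k --> \oo] --> g x.
  move=> /notE nE.
  have : cvgn (fun k => f (phi k) x).
    apply: (@cvgn_geometric_steps _ _ n) => k nk; apply: Estep; apply: nE => //.
    exact: leqW.
  move=> /cvg_ex[l fl]; rewrite /g.
  have -> : limn_esup (fun k => (f (phi k) x)%:E) = l%:E.
    by apply: (cvg_limn_einf_sup _).2; apply: cvg_EFin => //; exact: nearW.
  exact: fl.
exists g; split => //; exists (fun n => B n `&` ~` T n).
have mC n : measurable (B n `&` ~` T n).
  by apply: measurableI => //; exact: measurableC.
split => //.
  apply: (@squeeze_cvge _ _ _ _ (cst 0%E) _
      (fun n => mu (~` B n) + mu (T n))%E); last 2 first.
  - exact: cvg_cst.
  - by rewrite -[0%E]adde0; apply: cvgeD.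
  apply: nearW => n; rewrite measure_ge0/= setCI setCK.
  by apply: measureU2 => //; exact: measurableC.
apply/ge0_cvge0P => [n|e e_gt0].
  by apply: integral_ge0 => x _; rewrite lee_fin powR_ge0.
move/ge0_cvge0P : int0 => /(_ _ _ e_gt0)[].
  by move=> nm; apply: integral_ge0 => x _; rewrite lee_fin powR_ge0.
move=> [P Q] [/= [N1 _ N1P] [N2 _ N2P]] PQ.
exists N1 => // n /= N1n.
apply: (@fatou_powR _ _ _ _ _ p_gt0 _ _ _ _ (fun k => f (phi k))) => //.
- exact: measurable_funTS.
- by move=> k; exact: measurable_funTS.
- by move=> x [_]; exact: fg.
(* [n <= k] places [B n `\` T n] inside [B (phi k)]. *)
exists (maxn N2 n) => // k /=; rewrite geq_max => /andP[N2k nk].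
apply: le_trans (PQ (n, phi k) _); last first.
  by split; [exact: N1P|apply: N2P; exact: leq_trans (phi_ge k)].
apply: ge0_subset_integral => //.
- exact: measurableI.
- apply/measurable_EFinP; apply: measurable_powR_norm.
  by apply: measurable_funB; exact: measurable_funTS.
- by move=> x [Bx nTx]; split => //; apply: EB; exact: notE nk.
Qed.
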